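(* Let $G$ be a finite simple connected graph with ${\rm diam}(G)=2$. Then $G$ is a BDM graph.
   Context: All graphs are undirected, simple, finite and connected; a graph of order $n$ has vertex set $[n]=\{1,\ldots,n\}$ unless otherwise specified. $d_G(u,v)$ denotes the distance (length of a shortest path) between $u$ and $v$ in $G$, $N(v)$ denotes the open neighborhood of $v$, and ${\rm diam}(G)$ is the maximum distance between two vertices of $G$. A vertex $v$ is a boundary vertex of a vertex $u$ if $d_G(u,w)\le d_G(u,v)$ for every $w\in N(v)$; $\partial(u)$ is the set of boundary vertices of $u$, and the boundary of $G$ is $\partial(G)=\bigcup_{u\in V(G)}\partial(u)$. The boundary distance matrix $\hat{D}_G$ is the square matrix indexed by $\partial(G)$ with entries $[\hat{D}_G]_{ij}=d_G(i,j)$ for $i,j\in\partial(G)$. A graph $G$ of order $n$ is called a BDM graph (boundary-distance-matrix constructible) if it is uniquely determined by $\hat{D}_G$, provided that both $n$ and $\partial(G)$ are prescribed; that is, every connected graph $G'$ on the vertex set $V(G)$ with $\partial(G')=\partial(G)$ and $\hat{D}_{G'}=\hat{D}_G$ is isomorphic to $G$. *)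

(* Defs.v *)
From mathcomp Require Import all_boot all_order all_algebra.

Set Implicit Arguments.
Unset Strict Implicit.
Unset Printing Implicit Defensive.

(* Finite simple undirected connected graphs with vertex set T. *)
Record cgraph (T : finType) := CGraph {
  adj :> rel T;
  adj_sym : symmetric adj;
  adj_irrefl : irreflexive adj;
  adj_connected : forall u v, connect adj u v
}.

(* A path u = x_0, x_1, ..., x_k = v (distinct vertices) is encoded, as usual
   for [path], by its origin u and the tuple (x_1, ..., x_k). *)
Definition has_path_of_length (T : finType) (G : cgraph T) (u v : T) (k : nat)
    : bool :=
  [exists p : k.-tuple T, [&& path G u p, uniq (u :: p) & last u p == v]].

Lemma has_path (T : finType) (G : cgraph T) (u v : T) :
  exists k, has_path_of_length G u v k.
Proof.
case/connectP: (adj_connected G u v) => p Gp ->.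
case: (shortenP Gp) => q Gq Uq _.
exists (size q); apply/existsP; exists (in_tuple q).
by rewrite Gq Uq eqxx.
Qed.

Definition dist (T : finType) (G : cgraph T) (u v : T) : nat :=
  ex_minn (has_path G u v).

Definition diam (T : finType) (G : cgraph T) : nat :=
  \max_(u : T) \max_(v : T) dist G u v.

Definition neighborhood (T : finType) (G : cgraph T) (v : T) : {set T} :=
  [set w | G v w].

Definition boundary_of (T : finType) (G : cgraph T) (u : T) : {set T} :=
  [set v | [forall w in neighborhood G v, dist G u w <= dist G u v]].

Definition boundary (T : finType) (G : cgraph T) : {set T} :=
  \bigcup_(u : T) boundary_of G u.

(* Rows and columns are labelled by the boundary vertices through the
   canonical enumeration [enum_val] of the set [boundary G], which depends
   on that set only. *)
Definition boundary_distance_matrix (T : finType) (G : cgraph T)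
    : 'M[nat]_#|boundary G| :=
  \matrix_(i, j) dist G (enum_val i) (enum_val j).

Definition isomorphic (T1 T2 : finType) (G1 : cgraph T1) (G2 : cgraph T2)
    : Prop :=
  exists2 f : T1 -> T2, bijective f & forall x y, G2 (f x) (f y) = G1 x y.

(* Equal boundaries have the same enumeration, so the cast below, which only
   identifies the two index types, matches rows and columns carrying the same
   vertex label. *)
Definition BDM (T : finType) (G : cgraph T) : Prop :=
  forall (G' : cgraph T) (eqB : boundary G' = boundary G),
    let eqn := congr1 (fun B : {set T} => #|B|) eqB in
    castmx (eqn, eqn) (boundary_distance_matrix G') =
      boundary_distance_matrix G ->
    isomorphic G' G.

(* Main.v *)
Require Import Defs.
From mathcomp Require Import all_boot.
From mathcomp Require Import matrix.

(** In a graph of diameter 2, a vertex [v] outside the boundary is universal: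
    seen from any [u], some neighbour of [v] is farther away than [v], hence at
    distance at most 2, so [v] is within distance 1 of [u]
    ([nonboundary_adj]). Moreover there is at most one such vertex
    ([nonboundary_unique]): from another one [v'], the vertex [v] would have a
    neighbour at distance 2 from [v'], although [v'] is universal.

    Now let [G'] have the same boundary and the same boundary distances as the
    graph [G] of diameter 2. Two boundary vertices are adjacent exactly when
    their distance is 1, so [G] and [G'] agree on the boundary. If a vertex [v] is
    missing from the boundary, all other vertices are in it, so their mutual
    distances in [G'] are those in [G], at most 2. The argument for
    universality only uses these distances, so [v] is universal in [G'] as
    well as in [G]. Hence [G] and [G'] have the same edges, and the identity
    is an isomorphism. *)

Set Implicit Arguments.
Unset Strict Implicit.
Unset Printing Implicit Defensive.

Section Distance.

Variables (T : finType) (G : cgraph T).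
Implicit Types u v w : T.

Lemma dist_min u v k : has_path_of_length G u v k -> dist G u v <= k.
Proof. by rewrite /dist; case: ex_minnP => m _; apply. Qed.

Lemma dist_path u v : has_path_of_length G u v (dist G u v).
Proof. by rewrite /dist; case: ex_minnP. Qed.

Lemma dist0_eq u v : dist G u v = 0 -> u = v.
Proof.
move=> d0; have := dist_path u v; rewrite d0 => /existsP[p].
by rewrite (tuple0 p) => /and3P[_ _ /eqP].
Qed.

Lemma dist_xx u : dist G u u = 0.
Proof.
apply/eqP; rewrite -leqn0; apply: dist_min.
by apply/existsP; exists [tuple]; rewrite /= eqxx.
Qed.

Lemma dist_le1 u v : (dist G u v <= 1) = (u == v) || G u v.
Proof.
apply/idP/orP => [|[/eqP->|Guv]]; last 2 first.
- by rewrite dist_xx.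
- apply/dist_min/existsP; exists [tuple v].
  rewrite /= Guv eqxx !inE !andbT; apply/eqP => uv.
  by rewrite uv adj_irrefl in Guv.
case: (posnP (dist G u v)) => [/dist0_eq-> | d_gt0 d_le1]; first by left.
have d1 : dist G u v = 1 by apply/eqP; rewrite eqn_leq d_le1.
have := dist_path u v; rewrite d1 => /existsP[p].
case/tupleP: p => w p; rewrite (tuple0 p) /= => /and3P[/andP[Guw _] _ /eqP <-].
by right.
Qed.

Lemma dist_diam u v : dist G u v <= diam G.
Proof.
by rewrite /diam; apply: (bigmax_sup u) => //; apply: (bigmax_sup v).
Qed.

Lemma nonboundaryP v :
  reflect (forall u, exists2 w, G v w & dist G u v < dist G u w)
          (v \notin boundary G).
Proof.
apply: (iffP idP) => [vNB u | farther].
  have : v \notin boundary_of G u.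
    by apply: contra vNB => vB; apply/bigcupP; exists u.
  rewrite inE negb_forall => /existsP[w].
  by rewrite negb_imply inE -ltnNge => /andP[]; exists w.
apply/bigcupP => -[u _]; rewrite inE => /forall_inP vB.
have [w Gvw] := farther u; rewrite ltnNge => /negP[].
by apply: vB; rewrite inE.
Qed.

(** The distances from [u] are bounded outside [v] only, since a boundary
    distance matrix says nothing about the distances to [v]. *)
Lemma nonboundary_adj u v :
  v \notin boundary G -> u != v ->
  (forall w, w != v -> dist G u w <= 2) -> G u v.
Proof.
move=> /nonboundaryP/(_ u)[w Gvw lt_uvw] neq_uv le2.
have neq_wv : w != v by apply/eqP => wv; rewrite wv adj_irrefl in Gvw.
have : dist G u v <= 1 by rewrite -ltnS (leq_trans lt_uvw) ?le2.
by rewrite dist_le1 (negPf neq_uv).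
Qed.

(** Both vertices would be universal; but a universal vertex [u] is at distance
    at most 1 from every vertex, so that a universal [v] distinct from [u] has
    no neighbour farther from [u] than itself. *)
Lemma nonboundary_unique u v :
  diam G <= 2 -> u \notin boundary G -> v \notin boundary G -> u = v.
Proof.
move=> diam2 uNB vNB; apply/eqP; apply: contraT => neq_uv.
have universal x y : x \notin boundary G -> y != x -> G y x.
  move=> xNB neq_yx; apply: nonboundary_adj => // w _.
  exact: leq_trans (dist_diam _ _) diam2.
have [w _] := nonboundaryP _ vNB u; rewrite ltnNge => /negP[].
have le_uw : dist G u w <= 1.
  rewrite dist_le1; have [//|neq_uw] := eqVneq u w.
  by rewrite adj_sym universal // eq_sym.
apply: leq_trans le_uw _; rewrite lt0n.
by apply: contraNneq neq_uv => /dist0_eq->.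
Qed.

End Distance.

Lemma dist_eq_adj (T : finType) (G G' : cgraph T) u v :
  dist G u v = dist G' u v -> G u v = G' u v.
Proof.
move=> eqd; have [<-|neq_uv] := eqVneq u v; first by rewrite !adj_irrefl.
by have := dist_le1 G u v; rewrite eqd dist_le1 (negPf neq_uv).
Qed.

(** Stated for arbitrary sets, so that the cast disappears by eliminating the
    equality between them. *)
Lemma castmx_enum_val_inj (R : Type) (T : finType) (A B : {set T})
    (F F' : T -> T -> R) (eqAB : A = B)
    (eqn := congr1 (fun C : {set T} => #|C|) eqAB) :
  castmx (eqn, eqn)
      (\matrix_(i < #|A|, j < #|A|) F' (enum_val i) (enum_val j))%R =
    (\matrix_(i < #|B|, j < #|B|) F (enum_val i) (enum_val j))%R ->
  {in B &, F' =2 F}.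
Proof.
rewrite {}/eqn; case: B / eqAB; rewrite castmx_id => /matrixP eqM x y xA yA.
by have := eqM (enum_rank_in xA x) (enum_rank_in xA y);
   rewrite !mxE !enum_rankK_in.
Qed.

Theorem theorem6 (T : finType) (G : cgraph T) : diam G = 2 -> BDM G.
Proof.
move=> diamG G' eqB eqn /castmx_enum_val_inj eqd.
have diam2 : diam G <= 2 by rewrite diamG.
have dist2 x y : dist G x y <= 2 := leq_trans (dist_diam G x y) diam2.
have adj_nonboundary u v : v \notin boundary G -> G u v = G' u v.
  move=> vNB; have [->|neq_uv] := eqVneq u v; first by rewrite !adj_irrefl.
  have inB x : x != v -> x \in boundary G.
    by apply: contraR => xNB; apply/eqP/(nonboundary_unique diam2).
  rewrite (nonboundary_adj vNB neq_uv) // (@nonboundary_adj _ G') ?eqB //.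
  by move=> w neq_wv; rewrite eqd ?inB.
exists id => [|x y]; first by exists id.
have [yB | yNB] := boolP (y \in boundary G); last exact: adj_nonboundary.
have [xB | xNB] := boolP (x \in boundary G).
  by apply: dist_eq_adj; rewrite eqd.
by rewrite (adj_sym G) (adj_sym G') adj_nonboundary.
Qed.
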